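(* Let $M$ be an $n$-dimensional smooth manifold and let $HM$ be a parallelizable distribution of rank $k$ on $M$ with parallelization sections $X_1,\dots,X_k$. Then there exists a unique linear connection $\nabla:\mathfrak{X}(M)\times\Gamma(HM)\to\Gamma(HM)$ on $HM$ for which the parallelization sections are parallel, i.e. $$\nabla_Y X_i=0\qquad\text{for all }Y\in\mathfrak{X}(M)\text{ and all }i=1,\dots,k.$$
   Context: $\mathfrak{X}(M)$ is the $C^\infty(M)$-module of smooth vector fields on $M$. A distribution of rank $k$ on $M$ is a smooth rank-$k$ vector subbundle of $TM$; $\Gamma(HM)$ denotes the $C^\infty(M)$-module of smooth sections of $HM$. A distribution $HM$ of rank $k<n$ is parallelizable if it admits $k$ global smooth sections $X_1,\dots,X_k\in\Gamma(HM)$ that are linearly independent at every point (called parallelization sections), so that $HM=\mathrm{span}\{X_1,\dots,X_k\}$. A linear connection on $HM$ is a linear connection on the vector bundle $HM\to M$, i.e. a map $\nabla:\mathfrak{X}(M)\times\Gamma(HM)\to\Gamma(HM)$ that is $C^\infty(M)$-linear in the first argument, $\mathbb{R}$-linear in the second, and satisfies $\nabla_Y(fZ)=f\nabla_YZ+(Y\cdot f)Z$ for $f\in C^\infty(M)$. *)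

(* Defs.v *)
From HB Require Import structures.
From mathcomp Require Import all_boot all_order all_algebra.
From mathcomp Require Import all_classical all_reals.
From mathcomp Require Import topology normedtype derive.

Set Implicit Arguments.
Unset Strict Implicit.
Unset Printing Implicit Defensive.

Import Order.TTheory GRing.Theory Num.Theory.
Import numFieldNormedType.Exports.

Local Open Scope classical_set_scope.
Local Open Scope ring_scope.

Section EuclideanSmoothness.
Context {R : realType} {n : nat}.

(* Meaningful for open A only: 'D_v f x is a limit of values of f at points
   near x, which must lie in A for Ck to depend only on f restricted to A. *)
Fixpoint Ck {V : normedModType R} (m : nat) (A : set 'rV[R]_n)
    (f : 'rV[R]_n -> V) : Prop :=
  (forall x, A x -> {for x, continuous f}) /\
  if m is m'.+1 then
    forall i : 'I_n, (forall x, A x -> derivable f x (delta_mx 0 i)) /\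
                     Ck m' A (fun x => 'D_(delta_mx 0 i) f x)
  else True.

Definition Cinfty {V : normedModType R} (A : set 'rV[R]_n)
  (f : 'rV[R]_n -> V) : Prop := forall m, Ck m A f.

Lemma Ck_cont {V : normedModType R} m A (f : 'rV[R]_n -> V) :
  Ck m A f -> forall x, A x -> {for x, continuous f}.
Proof. by case: m => [|m] []. Qed.

Lemma Ck_le {V : normedModType R} m A (f : 'rV[R]_n -> V) :
  Ck m.+1 A f -> Ck m A f.
Proof.
elim: m f => [|m IH] f [cf df]; split => // i.
by have [? /IH ?] := df i.
Qed.

Lemma Ck_ext {V : normedModType R} m A (f g : 'rV[R]_n -> V) :
  open A -> (forall x, A x -> f x = g x) -> Ck m A f -> Ck m A g.
Proof.
move=> oA; have nfg (f' g' : 'rV[R]_n -> V) :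
    (forall x, A x -> f' x = g' x) ->
    forall x, A x -> \forall y \near x, f' y = g' y.
  by move=> fg x Ax; apply: filterS (open_nbhs_nbhs (conj oA Ax)) => y /fg.
have cont_ext (f' g' : 'rV[R]_n -> V) : (forall x, A x -> f' x = g' x) ->
    (forall x, A x -> {for x, continuous f'}) ->
    forall x, A x -> {for x, continuous g'}.
  move=> fg cf x Ax; rewrite /prop_for /continuous_at -fg//.
  apply: cvg_trans (cf x Ax); apply: near_eq_cvg.
    exact: nbhs_filter.
  exact: nfg fg _ Ax.
elim: m f g => [|m IH] f g fg [cf df].
  by split => //; exact: (cont_ext _ _ fg).
split => [|i]; first exact: (cont_ext _ _ fg).
have [dfi Cfi] := df i; split.
  by move=> x Ax; apply: near_eq_derivable (dfi x Ax); exact: (nfg _ _ fg).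
by apply: IH Cfi => x Ax; exact/near_eq_derive/(nfg _ _ fg).
Qed.

Lemma Ck_cst {V : normedModType R} m A (v : V) :
  open A -> Ck m A (fun=> v : V).
Proof.
move=> oA; elim: m v => [|m IH] v; split => //.
- by move=> x _; exact: cst_continuous.
- by move=> x _; exact: cst_continuous.
move=> i; split; first by move=> x _; exact: derivable_cst.
apply: Ck_ext (IH 0) => // x _; exact/esym/derive_cst.
Qed.

Lemma CkD {V : normedModType R} m A (f g : 'rV[R]_n -> V) :
  open A -> Ck m A f -> Ck m A g -> Ck m A (f + g).
Proof.
move=> oA; elim: m f g => [|m IH] f g [cf df] [cg dg]; split => //.
- by move=> x Ax; apply: continuousD; [exact: cf|exact: cg].
- by move=> x Ax; apply: continuousD; [exact: cf|exact: cg].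
move=> i; have [dfi Cfi] := df i; have [dgi Cgi] := dg i; split.
  by move=> x Ax; apply: derivableD; [exact: dfi|exact: dgi].
apply: Ck_ext (IH _ _ Cfi Cgi) => // x Ax.
by rewrite deriveD//; [exact: dfi|exact: dgi].
Qed.

Lemma CkM m A (f g : 'rV[R]_n -> R) :
  open A -> Ck m A f -> Ck m A g -> Ck m A (f * g).
Proof.
move=> oA; elim: m f g => [|m IH] f g Cf Cg; split => //.
- move=> x Ax.
  by apply: continuousM; [exact: Ck_cont Cf _ Ax|exact: Ck_cont Cg _ Ax].
- move=> x Ax.
  by apply: continuousM; [exact: Ck_cont Cf _ Ax|exact: Ck_cont Cg _ Ax].
move=> i; have [dfi Cfi] := Cf.2 i; have [dgi Cgi] := Cg.2 i; split.
  by move=> x Ax; apply: derivableM; [exact: dfi|exact: dgi].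
have := CkD oA (IH _ _ (Ck_le Cf) Cgi) (IH _ _ (Ck_le Cg) Cfi).
apply: Ck_ext => // x Ax.
by rewrite deriveM//; [exact: dfi|exact: dgi].
Qed.

End EuclideanSmoothness.

(* As chart_inv is a total function, the empty topological space has no chart;
   it is still a manifold, with the empty atlas. *)
Record chart (R : realType) (n : nat) (T : topologicalType) := Chart {
  chart_dom : set T;
  chart_img : set 'rV[R]_n;
  chart_map :> T -> 'rV[R]_n;
  chart_inv : 'rV[R]_n -> T;
  chart_dom_open : open chart_dom;
  chart_img_open : open chart_img;
  chart_mapP : forall p, chart_dom p -> chart_img (chart_map p);
  chart_invP : forall x, chart_img x -> chart_dom (chart_inv x);
  chart_mapK : forall p, chart_dom p -> chart_inv (chart_map p) = p;
  chart_invK : forall x, chart_img x -> chart_map (chart_inv x) = x;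
  chart_map_cont : forall p, chart_dom p -> {for p, continuous chart_map};
  chart_inv_cont : forall x, chart_img x -> {for x, continuous chart_inv} }.

(* The image under c of chart_dom c `&` O. *)
Definition chart_img_in (R : realType) n (T : topologicalType)
    (c : chart R n T) (O : set T) : set 'rV[R]_n :=
  chart_img c `&` chart_inv c @^-1` O.

(* The atlas is not required to be maximal. *)
Record smooth_manifold (R : realType) (n : nat) := SmoothManifold {
  carrier :> topologicalType;
  manifold_hausdorff : hausdorff_space carrier;
  manifold_second_countable : @second_countable carrier;
  atlas : set (chart R n carrier);
  atlas_cover : forall p, exists2 c, atlas c & chart_dom c p;
  atlas_compat : forall c d, atlas c -> atlas d ->
    Cinfty (chart_img_in c (chart_dom d)) (d \o chart_inv c) }.

Lemma chart_img_in_open (R : realType) n (T : topologicalType)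
    (c : chart R n T) (O : set T) : open O -> open (chart_img_in c O).
Proof.
move=> oO; rewrite openE => x [cx Ox].
have nc : nbhs x (chart_img c).
  by apply: open_nbhs_nbhs; split => //; exact: chart_img_open.
have nO : nbhs x (chart_inv c @^-1` O).
  by apply: (chart_inv_cont cx); apply: open_nbhs_nbhs; split.
exact: filterI nc nO.
Qed.

Section SmoothFunctions.
Context {R : realType} {n : nat} (M : smooth_manifold R n).

Definition smooth_on (O : set M) (f : M -> R) : Prop :=
  forall c, atlas c -> Cinfty (chart_img_in c O) (f \o chart_inv c).

Definition smooth (f : M -> R) : Prop := smooth_on setT f.

Definition smooth_pred : {pred M -> R} := fun f => `[< smooth f >].

Lemma smooth_subring : subring_closed smooth_pred.
Proof.
have oc (c : chart R n M) : open (chart_img_in c setT)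
  by apply: chart_img_in_open; exact: openT.
have sM f g : f \in smooth_pred -> g \in smooth_pred -> f * g \in smooth_pred.
  move=> /asboolP sf /asboolP sg; apply/asboolP => c ac m.
  by apply: (CkM (oc c)); [exact: sf|exact: sg].
have sC a : cst a \in smooth_pred.
  by apply/asboolP => c ac m; apply: Ck_cst.
split; [exact: sC| |exact: sM] => f g sf sg.
have /asboolP sNg := sM _ _ (sC (-1)) sg; move/asboolP: sf => sf.
apply/asboolP => c ac m.
apply: (Ck_ext (oc c)) (CkD (oc c) (sf c ac m) (sNg c ac m)) => x _ /=.
by rewrite -[LHS]/(f (chart_inv c x) + -1 * g (chart_inv c x)) mulN1r.
Qed.

Lemma smooth_submod : submod_closed smooth_pred.
Proof.
have [s1 sB sM] := smooth_subring.
split; first by rewrite -(subrr 1); exact: sB.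
move=> a f g sf sg.
have sC b : cst b \in smooth_pred.
  apply/asboolP => c ac m; apply: Ck_cst.
  by apply: chart_img_in_open; exact: openT.
have -> : a *: f + g = f * cst a - cst (-1) * g.
  by apply/funext => x; rewrite -[RHS]/(f x * a - (-1) * g x) mulN1r opprK mulrC.
by apply: (sB); apply: (sM).
Qed.

HB.instance Definition _ := GRing.isSubringClosed.Build (M -> R) smooth_pred
  smooth_subring.

Lemma smooth_scaler : GRing.scaler_closed smooth_pred.
Proof.
move=> a f sf; have [s0 sZ] := smooth_submod.
by rewrite -[a *: f]addr0; exact: sZ.
Qed.

HB.instance Definition _ := GRing.isScaleClosed.Build R (M -> R) smooth_pred
  smooth_scaler.

Record smooth_fun := SmoothFun {
  smooth_fun_val :> M -> R;
  smooth_funP : smooth_fun_val \in smooth_pred }.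

HB.instance Definition _ := [isSub for smooth_fun_val].
HB.instance Definition _ := [Choice of smooth_fun by <:].
HB.instance Definition _ := GRing.SubChoice_isSubComPzRing.Build
  (M -> R) smooth_pred smooth_fun smooth_subring.
HB.instance Definition _ := [SubZmodule_isSubLmodule of smooth_fun by <:].

End SmoothFunctions.
Arguments smooth_fun {R n} M.
Arguments smooth_pred {R n} M.

Section LinearAlgebra.
Context {K : pzRingType} {L : lmodType K}.

Definition linear_subspace (W : set L) : Prop :=
  W 0 /\ forall a u v, W u -> W v -> W (a *: u + v).

Definition lin_indep k (e : 'I_k -> L) : Prop :=
  forall a : 'I_k -> K, \sum_i a i *: e i = 0 -> forall i, a i = 0.

Definition is_basis (W : set L) k (e : 'I_k -> L) : Prop :=
  [/\ forall i, W (e i), lin_indep e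
    & forall w, W w -> exists a : 'I_k -> K, w = \sum_i a i *: e i].

End LinearAlgebra.

Section VectorFields.
Context {R : realType} {n : nat} (M : smooth_manifold R n).

(* T_p M, as the space of derivations of C^infty(M) at p. *)
Definition tangent_space (p : M) : set (smooth_fun M -> R) :=
  [set v | (forall (a : R) (f g : smooth_fun M), v (a *: f + g) = a * v f + v g) /\
           (forall f g : smooth_fun M, v (f * g) = f p * v g + g p * v f)].

(* X is smooth on O when q |-> X_q f is smooth on O for all f in C^infty(M). *)
Definition smooth_vfield_on (O : set M) (X : M -> smooth_fun M -> R) : Prop :=
  (forall q, O q -> tangent_space q (X q)) /\
  (forall f, smooth_on O (fun q => X q f)).

Definition vfield_pred : {pred M -> smooth_fun M -> R} :=
  fun X => `[< smooth_vfield_on setT X >].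

Lemma tangent_space_subspace p : linear_subspace (tangent_space p).
Proof.
split; first by split => *; rewrite /= ?mulr0 ?addr0.
move=> b u v [uZ uM] [vZ vM]; split=> [a f g|f g].
  rewrite -![(b *: u + v) _]/(b * u _ + v _) uZ vZ !mulrDr !mulrA.
  by rewrite [b * a]mulrC -!addrA; congr (_ + _); rewrite addrCA.
rewrite -![(b *: u + v) _]/(b * u _ + v _) uM vM !mulrDr !mulrA.
rewrite ![b * _]mulrC -!addrA; congr (_ + _).
by rewrite addrCA.
Qed.

Lemma vfield_submod : submod_closed vfield_pred.
Proof.
have [T0 TZ] := (fun p => (tangent_space_subspace p).1,
                 fun p => (tangent_space_subspace p).2).
have [S0 SZ] := smooth_submod M.
split; first by apply/asboolP; split=> [q _|f]; [exact: T0|exact/asboolP].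
move=> a X Y /asboolP[tX sX] /asboolP[tY sY]; apply/asboolP; split=> [q _|f].
  by apply: TZ; [exact: tX|exact: tY].
by apply/asboolP; apply: (SZ a (X^~ f) (Y^~ f)); apply/asboolP;
  [exact: sX|exact: sY].
Qed.

Lemma vfield_zmod : zmod_closed vfield_pred.
Proof. exact: (GRing.submod_closedB vfield_submod). Qed.

HB.instance Definition _ := GRing.isZmodClosed.Build _ vfield_pred vfield_zmod.

Record vfield := VField {
  vfield_val :> M -> smooth_fun M -> R;
  vfieldP : vfield_val \in vfield_pred }.

HB.instance Definition _ := [isSub for vfield_val].
HB.instance Definition _ := [Choice of vfield by <:].
HB.instance Definition _ := [SubChoice_isSubZmodule of vfield by <:].

Lemma vfield_scale_subproof (f : smooth_fun M) (X : vfield) :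
  (fun p g => f p * X p g) \in vfield_pred.
Proof.
have /asboolP[tX sX] := vfieldP X; apply/asboolP; split=> [q _|g].
  have [T0 TZ] := tangent_space_subspace q.
  have := TZ (f q) _ _ (tX q I) T0; rewrite addr0; exact.
have sXg : (fun q => X q g) \in smooth_pred M by apply/asboolP; exact: sX.
by apply/asboolP; exact: (rpredM (smooth_funP f) sXg).
Qed.

Definition vfield_scale (f : smooth_fun M) (X : vfield) : vfield :=
  VField (vfield_scale_subproof f X).

Lemma vfieldE (X Y : vfield) : (forall p g, X p g = Y p g) -> X = Y.
Proof. by move=> XY; apply: val_inj; apply/funext => p; apply/funext. Qed.

Fact vfield_scalerA f g X :
  vfield_scale f (vfield_scale g X) = vfield_scale (f * g) X.
Proof. by apply: vfieldE => p h /=; rewrite mulrA. Qed.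

Fact vfield_scale1r : left_id 1 vfield_scale.
Proof. by move=> X; apply: vfieldE => p h /=; rewrite mul1r. Qed.

Fact vfield_scalerDr : right_distributive vfield_scale +%R.
Proof. by move=> f X Y; apply: vfieldE => p h /=; rewrite mulrDr. Qed.

Fact vfield_scalerDl X : {morph vfield_scale^~ X : f g / f + g}.
Proof. by move=> f g; apply: vfieldE => p h /=; rewrite mulrDl. Qed.

HB.instance Definition _ := GRing.Zmodule_isLmodule.Build (smooth_fun M) vfield
  vfield_scalerA vfield_scale1r vfield_scalerDr vfield_scalerDl.

Lemma vfield_app_subproof (X : vfield) (f : smooth_fun M) :
  (fun p => X p f) \in smooth_pred M.
Proof. by have /asboolP[_ sX] := vfieldP X; apply/asboolP; exact: sX. Qed.

Definition vfield_app (X : vfield) (f : smooth_fun M) : smooth_fun M :=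
  SmoothFun (vfield_app_subproof X f).

(* A rank-k subbundle of TM: a subspace of each tangent space, having around
   every point a local frame of k smooth vector fields (so that each fibre has
   dimension k). *)
Record distribution (k : nat) := Distribution {
  fibre :> forall p : M, set (smooth_fun M -> R);
  fibre_tangent : forall p, fibre p `<=` tangent_space p;
  fibre_subspace : forall p, linear_subspace (fibre p);
  fibre_frame : forall p, exists O (V : 'I_k -> M -> smooth_fun M -> R),
    [/\ open_nbhs p O, forall i, smooth_vfield_on O (V i)
      & forall q, O q -> is_basis (fibre q) (fun i => V i q)] }.

End VectorFields.
Arguments vfield {R n} M.
Arguments distribution {R n} M k.

Section Connections.
Context {R : realType} {n k : nat} {M : smooth_manifold R n}.
Variable H : distribution M k.

Definition section_pred : {pred vfield M} :=
  fun X => `[< forall p, H p (X p) >].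

Lemma section_submod : submod_closed section_pred.
Proof.
split; first by apply/asboolP => p; have [] := fibre_subspace H p.
move=> f X Y /asboolP HX /asboolP HY; apply/asboolP => p.
have [_ HZ] := fibre_subspace H p; exact: (HZ (f p)).
Qed.

HB.instance Definition _ := GRing.isSubmodClosed.Build _ _ section_pred
  (GRing.submod_closed_semi section_submod).

Record smooth_section := SmoothSection {
  section_val :> vfield M;
  sectionP : section_val \in section_pred }.

HB.instance Definition _ := [isSub for section_val].
HB.instance Definition _ := [Choice of smooth_section by <:].
HB.instance Definition _ := [SubChoice_isSubZmodule of smooth_section by <:].
HB.instance Definition _ := [SubZmodule_isSubLmodule of smooth_section by <:].

(* R acts on sections through the constant functions a *: 1. *)
Record is_connection (nabla : vfield M -> smooth_section -> smooth_section) : Prop := {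
  connectionDl : forall (f : smooth_fun M) Y1 Y2 Z,
    nabla (f *: Y1 + Y2) Z = f *: nabla Y1 Z + nabla Y2 Z;
  connectionDr : forall (a : R) Y Z1 Z2,
    nabla Y ((a *: (1 : smooth_fun M)) *: Z1 + Z2) =
      (a *: (1 : smooth_fun M)) *: nabla Y Z1 + nabla Y Z2;
  connection_leibniz : forall (f : smooth_fun M) Y Z,
    nabla Y (f *: Z) = f *: nabla Y Z + vfield_app Y f *: Z }.

Definition parallelization_sections (X : 'I_k -> smooth_section) : Prop :=
  forall p, lin_indep (fun i => X i p).

End Connections.

(* Main.v *)
Require Import Defs.
From mathcomp Require Import all_boot all_order all_algebra.
From mathcomp Require Import perm.
From mathcomp Require Import all_classical all_reals.
From mathcomp Require Import topology normedtype derive.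

Local Open Scope classical_set_scope.
Local Open Scope ring_scope.

Import Order.TTheory GRing.Theory Num.Theory.
Import numFieldNormedType.Exports.

(** The sections of [H] form a free module over the smooth functions, with basis
    the parallelization sections [X i]: every section is [\sum_i a i *: X i] for
    unique smooth functions [a i] ([section_expansion],
    [section_expansion_inj]). A connection for which the [X i] are parallel must
    then, by the Leibniz rule, send [\sum_i a i *: X i] to
    [\sum_i (Y a i) *: X i] ([parallel_connectionE]), which gives uniqueness;
    conversely this formula defines a connection, since [Y] is a derivation
    ([parallel_connection_exists]).

    The substance lies in the smoothness of the coefficients. At each point the
    [X i] are independent in a fibre of dimension [k], hence a basis of it
    ([is_basis_lin_indep]), and this determines the functions [a i]. Tangent
    vectors being functionals on smooth functions, the independence of the
    [X i p] yields global smooth functions [t j] such that the matrix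
    [X i p (t j)] is invertible ([lin_indep_evaluations]). It remains invertible
    near [p], where Cramer's rule writes the [a i] as quotients of smooth
    functions ([smooth_quotient]). Neither coordinate frames nor bump functions
    are needed. *)

(** * Linear algebra over a field *)

(** Linearly independent functions [v i] are separated by finitely many points.
    The determinant, expanded along the column that carries one
    further point [t], is a linear combination of the [v i t] in which one
    coefficient is the minor that induction makes nonzero. *)
Lemma lin_indep_evaluations (K : fieldType) (T : Type) (k : nat)
    (v : 'I_k -> T -> K) :
  (forall a : 'I_k -> K, (forall t, \sum_i a i * v i t = 0) ->
     forall i, a i = 0) ->
  exists t : 'I_k -> T, \det (\matrix_(i, j) v i (t j)) != 0.
Proof.
elim: k v => [|k IH] v indep.
  have t (i : 'I_0) : T by case: i.
  by exists t; rewrite det_mx00 oner_eq0.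
have [a a0|t dt] := IH (fun i => v (lift ord0 i)).
  have h t : \sum_i (if unlift ord0 i is Some j then a j else 0) * v i t = 0.
    rewrite big_ord_recl unlift_none mul0r add0r -[RHS](a0 t).
    by apply: eq_bigr => i _; rewrite liftK.
  by move=> i; have := indep _ h (lift ord0 i); rewrite liftK.
(* The points [t], with [x] inserted at index 0. *)
pose ext x j := if unlift ord0 j is Some j' then t j' else x.
pose A x := \matrix_(i, j) v i (ext x j).
have [[x dx]|no] := pselect (exists x, \det (A x) != 0).
  by exists (ext x).
have coefE x y i : cofactor (A x) i ord0 = cofactor (A y) i ord0.
  rewrite /cofactor; congr (_ * \det _); apply/matrixP => a b.
  by rewrite !mxE /ext liftK.
have [x0 _] : exists x0 : T, True.
  apply: contrapT => nT.
  have h t' : \sum_i (fun=> 1) i * v i t' = 0 by case: nT; exists t'.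
  by have /eqP := indep (fun=> 1) h ord0; rewrite oner_eq0.
have /(indep _)/(_ ord0) : forall x, \sum_i cofactor (A x0) i ord0 * v i x = 0.
  move=> x; have /negP/negPn/eqP : ~ (\det (A x) != 0).
    by move=> dx; apply: no; exists x.
  apply: etrans; rewrite (expand_det_col _ ord0); apply: eq_bigr => i _.
  by rewrite mulrC (coefE x0 x) mxE /ext unlift_none.
suff -> : cofactor (A x0) ord0 ord0 =
    \det (\matrix_(i, j) v (lift ord0 i) (t j)) by move/eqP: dt.
(* Removing the row and the column of index 0 leaves the smaller matrix. *)
rewrite /cofactor addn0 expr0 mul1r; congr (\det _).
by apply/matrixP => a b; rewrite !mxE /ext liftK.
Qed.

(** As many linearly independent vectors as the dimension form a basis. *)
Lemma is_basis_lin_indep (K : fieldType) (L : lmodType K) (W : set L) (k : nat)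
    (e x : 'I_k -> L) :
  is_basis W e -> lin_indep x -> (forall i, W (x i)) -> is_basis W x.
Proof.
case=> We indep_e span_e indep_x Wx; split=> // w /span_e[b ->].
have /choice[c cE] := fun i => span_e _ (Wx i).
pose B := \matrix_(i, j) c i j.
have sum_x (a : 'rV[K]_k) : \sum_i a 0 i *: x i = \sum_j (a *m B) 0 j *: e j.
  under eq_bigr do rewrite cE scaler_sumr.
  rewrite exchange_big; apply: eq_bigr => j _.
  rewrite mxE scaler_suml; apply: eq_bigr => i _.
  by rewrite mxE scalerA.
have uB : B \in unitmx.
  rewrite -row_free_unit -kermx_eq0; apply/eqP/row_matrixP => r.
  apply/rowP => i; rewrite row0 [RHS]mxE.
  apply: (indep_x (fun i => row r (kermx B) 0 i)).
  rewrite sum_x -row_mul mulmx_ker row0.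
  by apply: big1 => j _; rewrite mxE scale0r.
exists (fun i => (\row_j b j *m invmx B) 0 i).
rewrite sum_x mulmxKV//; apply: eq_bigr => j _.
by rewrite mxE.
Qed.

(** * Functions of class C^m on open subsets of R^n *)

Lemma Ck_sub {R : realType} {n : nat} {V : normedModType R} m
    (A B : set 'rV[R]_n) (f : 'rV[R]_n -> V) :
  A `<=` B -> Ck m B f -> Ck m A f.
Proof.
move=> AB; elim: m f => [|m IH] f [cf df].
  by split => // x /AB /cf.
split => [x /AB /cf //|i]; have [dfi Cfi] := df i.
by split; [move=> x /AB /dfi|exact: IH].
Qed.

Lemma Ck_local {R : realType} {n : nat} {V : normedModType R} m
    (A : set 'rV[R]_n) (f : 'rV[R]_n -> V) :
  (forall x, A x -> exists2 B : set 'rV[R]_n, B x & Ck m B f) -> Ck m A f.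
Proof.
elim: m f => [|m IH] f loc.
  by split => // x /loc[B Bx [cf _]]; exact: cf.
split => [x /loc[B Bx [cf _]]|i]; first exact: cf.
split=> [x /loc[B Bx [_ /(_ i)[df _]]]|]; first exact: df.
by apply: IH => x /loc[B Bx [_ /(_ i)[_ df]]]; exists B.
Qed.

Lemma CkV {R : realType} {n : nat} m (A : set 'rV[R]_n) (f : 'rV[R]_n -> R) :
  open A -> (forall x, A x -> f x != 0) -> Ck m A f ->
  Ck m A (fun x => (f x)^-1).
Proof.
move=> oA f0; elim: m => [|m IH] Cf.
  by split => // x Ax; apply: continuousV; [exact: f0|exact: Ck_cont Cf _ Ax].
split=> [x Ax|i].
  by apply: continuousV; [exact: f0|exact: Ck_cont Cf _ Ax].
have [dfi Cfi] := Cf.2 i; split=> [x Ax|].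
  by apply: derivableV; [exact: f0|exact: dfi].
have CV := IH (Ck_le Cf).
have CN1 : Ck m A (fun=> -1 : R) by exact: Ck_cst.
have := CkM oA (CkM oA CN1 (CkM oA CV CV)) Cfi.
apply: Ck_ext => // x Ax; rewrite deriveV; [|exact: f0|exact: dfi].
by rewrite -[LHS]/(-1 * ((f x)^-1 * (f x)^-1) * _) mulN1r -expr2 exprVn.
Qed.

(** * Smooth functions on a manifold *)

Lemma smooth_det {R : realType} {n : nat} (M : smooth_manifold R n) (k : nat)
    (A : M -> 'M[R]_k) :
  (forall i j, (fun q => A q i j) \in smooth_pred M) ->
  (fun q => \det (A q)) \in smooth_pred M.
Proof.
move=> sA.
have -> : (fun q => \det (A q)) =
    \sum_(s : 'S_k) (-1) ^+ s *: \prod_i (fun q => A q i (s i)).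
  apply/funext => q; rewrite fct_sumE; apply: eq_bigr => s _.
  by rewrite fct_prodE.
apply: rpred_sum => s _; apply: rpredZ; apply: rpred_prod => i _.
exact: sA.
Qed.

(** Near [p], [f] is the quotient of [h] by the nonvanishing function [D]; as
    smoothness is local, [f] is smooth. *)
Lemma smooth_quotient {R : realType} {n : nat} (M : smooth_manifold R n)
    (f : M -> R) :
  (forall p, exists D h : M -> R, [/\ D \in smooth_pred M, h \in smooth_pred M,
     D p != 0 & forall q, f q * D q = h q]) ->
  f \in smooth_pred M.
Proof.
move=> loc; apply/asboolP => c ac m; apply: Ck_local => x Ax.
have [D [h [/asboolP sD /asboolP sh Dp fD]]] := loc (chart_inv c x).
pose A := chart_img_in c setT; pose g := D \o chart_inv c.
have oA : open A by apply: chart_img_in_open; exact: openT.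
pose B : set 'rV[R]_n := (A `&` g @^-1` [set y | y != 0])°.
have BA : B `<=` A by move=> y /interior_subset[].
have g0 y : B y -> g y != 0 by move=> /interior_subset[].
exists B.
  apply: filterI; first exact: open_nbhs_nbhs.
  have cg := Ck_cont (sD c ac 0%N) Ax; apply: cg.
  by apply: open_nbhs_nbhs; split; [exact: open_neq|].
have oB : open B by exact: open_interior.
have CV := CkV m B g oB g0 (Ck_sub m B A g BA (sD c ac m)).
apply: Ck_ext (CkM oB (Ck_sub m B A _ BA (sh c ac m)) CV) => // y By.
rewrite -[LHS]/(h (chart_inv c y) * (g y)^-1) -fD.
by rewrite -mulrA divff ?mulr1//; exact: g0.
Qed.

(** * Global frames of a distribution *)

Lemma section_sumE {R : realType} {n k : nat} {M : smooth_manifold R n}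
    {H : distribution M k} (a : 'I_k -> smooth_fun M)
    (X : 'I_k -> smooth_section H) (p : M) :
  (\sum_i a i *: X i) p = \sum_i a i p *: X i p.
Proof. exact: (big_morph (fun Z : smooth_section H => (Z : vfield M) p)). Qed.

(** Every section is a combination of the parallelization sections [X i].
    Pointwise the coefficients exist for dimension reasons. Evaluating on
    functions [t j] with [\det (X i p (t j)) != 0], Cramer's rule exhibits them
    near [p] as quotients of smooth functions. *)
Lemma section_expansion {R : realType} {n k : nat} {M : smooth_manifold R n}
    {H : distribution M k} (X : 'I_k -> smooth_section H) :
  parallelization_sections X ->
  forall Z : smooth_section H,
    exists a : 'I_k -> smooth_fun M, Z = \sum_i a i *: X i.
Proof.
move=> hX Z; have HE (Y : smooth_section H) p : H p (Y p).
  by have /asboolP := sectionP Y.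
have basis p : is_basis (H p) (fun i => X i p).
  have [O [V [Op _ /(_ p)bV]]] := fibre_frame H p.
  case: Op => _ Op.
  by apply: is_basis_lin_indep (bV Op) (hX p) _ => i; exact: HE.
have /choice[b bE] : forall p, exists b : 'I_k -> R, Z p = \sum_i b i *: X i p.
  by move=> p; have [_ _] := basis p; apply.
have sb i : (fun p => b p i) \in smooth_pred M.
  apply: smooth_quotient => p.
  have [|t dt] := lin_indep_evaluations R (smooth_fun M) k (fun i => X i p).
    move=> a a0; apply: (hX p); apply/funext => f.
    by rewrite fct_sumE -[RHS](a0 f).
  pose B q := \matrix_(i, j) X i q (t j).
  have sX (Y : smooth_section H) f : (fun q => Y q f) \in smooth_pred M.
    exact: (smooth_funP (vfield_app Y f)).
  exists (fun q => \det (B q)).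
  exists (fun q => \sum_j Z q (t j) * cofactor (B q) i j).
  split=> [|||q].
  - by apply: smooth_det => r s; under eq_fun do rewrite mxE; exact: sX.
  - rewrite -[X in X \in _]/(fun q => _) -fct_sumE.
    apply: rpred_sum => j _; apply: rpredM; first exact: sX.
    rewrite /cofactor; apply: (rpredZ ((-1) ^+ (i + j))).
    apply: smooth_det => r s; under eq_fun do rewrite !mxE; exact: sX.
  - exact: dt.
  (* Cramer's rule: multiply [z = b *m B] by the adjugate of [B]. *)
  have ZB : \row_j Z q (t j) = \row_i b q i *m B q.
    apply/rowP => j; rewrite !mxE bE fct_sumE.
    by apply: eq_bigr => r _; rewrite !mxE.
  have := congr1 (fun z => (z *m \adj (B q)) 0 i) ZB.
  rewrite -mulmxA mul_mx_adj mul_mx_scalar !mxE mulrC => <-.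
  by apply: eq_bigr => j _; rewrite !mxE.
exists (fun i => SmoothFun (sb i)).
apply: val_inj; apply: vfieldE => p g.
by rewrite /= section_sumE bE.
Qed.

Lemma section_expansion_inj {R : realType} {n k : nat} {M : smooth_manifold R n}
    {H : distribution M k} (X : 'I_k -> smooth_section H)
    (a b : 'I_k -> smooth_fun M) :
  parallelization_sections X ->
  \sum_i a i *: X i = \sum_i b i *: X i -> forall i, a i = b i.
Proof.
move=> hX ab i; apply: val_inj; apply/funext => p /=.
apply/eqP; rewrite -subr_eq0; apply/eqP; move: i; apply: (hX p).
under eq_bigr do rewrite scalerBl.
by rewrite sumrB -!section_sumE ab subrr.
Qed.

(** * Vector fields as derivations *)

Section VectorFieldDerivation.
Context {R : realType} {n : nat} {M : smooth_manifold R n}.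
Implicit Types (Y : vfield M) (f g : smooth_fun M).

Lemma vfield_app_linear Y (a : R) f g :
  vfield_app Y (a *: f + g) = a *: vfield_app Y f + vfield_app Y g.
Proof.
have /asboolP[tY _] := vfieldP Y.
by apply: val_inj; apply/funext => p; have [lin _] := tY p I; exact: lin.
Qed.

Lemma vfield_appM Y f g :
  vfield_app Y (f * g) = f * vfield_app Y g + g * vfield_app Y f.
Proof.
have /asboolP[tY _] := vfieldP Y.
by apply: val_inj; apply/funext => p; have [_ leib] := tY p I; exact: leib.
Qed.

Lemma vfield_app0 Y : vfield_app Y 0 = 0.
Proof.
have := vfield_app_linear Y 1 0 0.
rewrite !scale1r addr0 => /eqP.
by rewrite -subr_eq0 opprD addrA subrr sub0r oppr_eq0 => /eqP.
Qed.

Lemma vfield_app1 Y : vfield_app Y 1 = 0.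
Proof.
have := vfield_appM Y 1 1.
rewrite !mul1r => /eqP.
by rewrite -subr_eq0 opprD addrA subrr sub0r oppr_eq0 => /eqP.
Qed.

Lemma vfield_appDl f Y1 Y2 g :
  vfield_app (f *: Y1 + Y2) g = f * vfield_app Y1 g + vfield_app Y2 g.
Proof. by apply: val_inj. Qed.

End VectorFieldDerivation.

(** * The connection attached to a parallelization *)

Section ParallelConnection.
Context {R : realType} {n k : nat} {M : smooth_manifold R n}.
Context {H : distribution M k}.
Implicit Types (X : 'I_k -> smooth_section H).
Implicit Types (nabla : vfield M -> smooth_section H -> smooth_section H).

(** A connection making the [X i] parallel differentiates coefficients. *)
Lemma parallel_connectionE X nabla (Y : vfield M) (a : 'I_k -> smooth_fun M) :
  is_connection nabla -> (forall i, nabla Y (X i) = 0) ->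
  nabla Y (\sum_i a i *: X i) = \sum_i vfield_app Y (a i) *: X i.
Proof.
case=> _ lin leib par.
have nablaD Z1 Z2 : nabla Y (Z1 + Z2) = nabla Y Z1 + nabla Y Z2.
  by have := lin 1 Y Z1 Z2; rewrite !scale1r.
have nabla0 : nabla Y 0 = 0.
  by apply: (addIr (nabla Y 0)); rewrite -nablaD !add0r.
rewrite (big_morph (nabla Y) nablaD nabla0); apply: eq_bigr => i _.
by rewrite leib par scaler0 add0r.
Qed.

Lemma parallel_connection_exists X :
  parallelization_sections X ->
  exists nabla, is_connection nabla /\ forall Y i, nabla Y (X i) = 0.
Proof.
move=> hX; have /choice[coef coefE] := section_expansion X hX.
have coefP (Z : smooth_section H) a :
    Z = \sum_i a i *: X i -> forall i, coef Z i = a i.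
  by move=> Za; apply: (section_expansion_inj X) => //; rewrite -coefE.
have coefX i j : coef (X i) j = (j == i)%:R.
  move: j; apply: coefP; rewrite (bigD1 i)//= eqxx scale1r big1 ?addr0// => j.
  by move=> /negPf ->; rewrite scale0r.
have coefZ f Z i : coef (f *: Z) i = f * coef Z i.
  move: i; apply: coefP; rewrite {1}(coefE Z) scaler_sumr.
  by apply: eq_bigr => i _; rewrite scalerA.
have coefD Z1 Z2 i : coef (Z1 + Z2) i = coef Z1 i + coef Z2 i.
  move: i; apply: coefP; rewrite {1}(coefE Z1) {1}(coefE Z2) -big_split.
  by apply: eq_bigr => i _; rewrite scalerDl.
exists (fun Y Z => \sum_i vfield_app Y (coef Z i) *: X i); split; first split.
- move=> f Y1 Y2 Z; rewrite scaler_sumr -big_split; apply: eq_bigr => i _.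
  by rewrite vfield_appDl scalerDl scalerA.
- move=> a Y Z1 Z2; rewrite scaler_sumr -big_split; apply: eq_bigr => i _ /=.
  have sclE (f : smooth_fun M) : a *: (1 : smooth_fun M) * f = a *: f.
    by apply: val_inj; apply/funext => p; rewrite -[LHS]/(a * 1 * f p) mulr1.
  by rewrite coefD coefZ sclE vfield_app_linear scalerDl scalerA sclE.
- move=> f Y Z; rewrite {3}(coefE Z) !scaler_sumr -big_split.
  apply: eq_bigr => i _ /=.
  by rewrite coefZ vfield_appM scalerDl !scalerA [coef Z i * _]mulrC.
move=> Y i; apply: big1 => j _; rewrite coefX.
by case: eqP => _; rewrite ?vfield_app1 ?vfield_app0 scale0r.
Qed.

End ParallelConnection.

Theorem theorem3p1 (R : realType) (n k : nat) (hkn : (k < n)%N)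
    (M : smooth_manifold R n) (H : distribution M k)
    (X : 'I_k -> smooth_section H) (hX : parallelization_sections X) :
  exists! nabla : vfield M -> smooth_section H -> smooth_section H,
    is_connection nabla /\
    (forall (Y : vfield M) (i : 'I_k), nabla Y (X i) = 0).
Proof.
have [nabla [conn par]] := parallel_connection_exists X hX.
exists nabla; split=> // nabla' [conn' par'].
apply/funext => Y; apply/funext => Z; have [a ->] := section_expansion X hX Z.
by rewrite !parallel_connectionE.
Qed.
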